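(* Let $A_\Gamma$ be an Artin group with standard generating set $X$ and positive monoid $M$. Suppose that $A_\Gamma$ has preserved signed suffixes, and that $A_\Gamma$ contains an alternating blocking sequence of words $\{\alpha_n\}_{n\ge 1}$. Then the monoid Cayley graph $\mathrm{Cay}(A_\Gamma,M)$ has infinite diameter.
   Context: Artin group: let $\Gamma$ be a finite simple graph with vertex set $X=\{x_1,\dots,x_n\}$ and edges labelled by integers $m_{i,j}=m_{j,i}\ge2$. Then $A_\Gamma=\langle X\mid \underbrace{x_ix_jx_i\cdots}_{m_{i,j}}=\underbrace{x_jx_ix_j\cdots}_{m_{i,j}}$ for every edge $\{x_i,x_j\}\rangle$; $X$ is the standard generating set. The monoid with the same presentation is identified (theorem of Paris) with the submonoid $M=A_\Gamma^+$ of $A_\Gamma$ of elements represented by positive words in $X$. Monoid Cayley graph $\mathrm{Cay}(A_\Gamma,M)$: vertices are the elements of $A_\Gamma$; $g,h$ are joined by an edge whenever $h=gm$ or $g=hm$ for some $m\in M$; path metric with edges of length 1. Words: a word over $X$ is a finite string over $X\cup X^{-1}$. It is positive (negative) if all its letters lie in $X$ (in $X^{-1}$). It is geodesic if it has minimal length among all words over $X$ representing the same element of $A_\Gamma$. Preserved signed suffixes: $A_\Gamma$ has preserved positive (resp. negative) suffixes if for every geodesic word $w$ over $X$ ending in a positive (resp. negative) letter, and every letter $a\in X$ (resp. $a\in X^{-1}$), the element of $A_\Gamma$ represented by $aw$ is represented by some geodesic word over $X$ having $u$ as a suffix, where $u$ is the longest positive (resp. negative) proper suffix of $w$. $A_\Gamma$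 has preserved signed suffixes if it has both preserved positive and preserved negative suffixes. Blocking pair: for a word $u$ over $X$ and a letter $x\in X\cup X^{-1}$, $(u,x)$ is a blocking pair if for every word $w$ such that $wu$ is a geodesic word over $X$, the word $wux$ is also a geodesic word over $X$. Alternating blocking sequence: an infinite sequence $\{\alpha_n\}_{n\ge1}$ of words over $X$, where $\alpha_n$ is a nonempty positive word for $n$ odd and a nonempty negative word for $n$ even, such that for every $n\ge 2$ and every letter (occurrence) $x$ in $\alpha_n$ there is a subword $u$ of $\alpha_{n-1}\alpha_n$ immediately preceding that occurrence of $x$ such that $(u,x)$ is a blocking pair. *)

(* Defs.v *)
From HB Require Import structures.
From mathcomp Require Import all_boot.
From mathcomp Require Import boolp classical_sets.

Set Implicit Arguments.
Unset Strict Implicit.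
Unset Printing Implicit Defensive.

Local Open Scope quotient_scope.

(* A letter (x, true) stands for x and (x, false) for its formal inverse. *)
Notation letter T := (T * bool)%type.
Notation word T := (seq (letter T)).

Definition inv_letter (T : Type) (a : letter T) : letter T := (a.1, ~~ a.2).

Definition inv_word (T : Type) (w : word T) : word T :=
  rev (map (@inv_letter T) w).

Definition signed (T : Type) (b : bool) (w : word T) : bool :=
  all (fun a => a.2 == b) w.

Definition positive (T : Type) (w : word T) : bool := signed true w.
Definition negative (T : Type) (w : word T) : bool := signed false w.

(* The congruence on words generated by free cancellation and the defining
   relations u = v with R u v: two words are related if and only if they
   represent the same element of the group < T | u = v, R u v >. *)
Inductive word_eq (T : Type) (R : word T -> word T -> Prop) :
    word T -> word T -> Prop :=
  | word_eq_refl w : word_eq R w w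
  | word_eq_sym u v : word_eq R u v -> word_eq R v u
  | word_eq_trans u v w : word_eq R u v -> word_eq R v w -> word_eq R u w
  | word_eq_cancel p a q : word_eq R (p ++ [:: a; inv_letter a] ++ q) (p ++ q)
  | word_eq_rel p u v q : R u v -> word_eq R (p ++ u ++ q) (p ++ v ++ q).

Lemma inv_letterK T : involutive (@inv_letter T).
Proof. by case=> x b; rewrite /inv_letter negbK. Qed.

Lemma inv_wordK T : involutive (@inv_word T).
Proof.
by move=> w; rewrite /inv_word map_rev revK mapK //; exact: inv_letterK.
Qed.

Lemma inv_word_cat T (u v : word T) :
  inv_word (u ++ v) = inv_word v ++ inv_word u.
Proof. by rewrite /inv_word map_cat rev_cat. Qed.

Section PresentedGroup.
Context (T : choiceType) (R : word T -> word T -> Prop).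

Local Notation "u =~ v" := (word_eq R u v) (at level 70).

Lemma word_eq_catl p u v : u =~ v -> p ++ u =~ p ++ v.
Proof.
elim=> [w|u' v' _|u' v' w' _ + _|p' a q|p' u' v' q uv].
- exact: word_eq_refl.
- exact: word_eq_sym.
- exact: word_eq_trans.
- by rewrite !(catA p); exact: word_eq_cancel.
- by rewrite !(catA p); exact: word_eq_rel.
Qed.

Lemma word_eq_catr q u v : u =~ v -> u ++ q =~ v ++ q.
Proof.
elim=> [w|u' v' _|u' v' w' _ + _|p' a q'|p' u' v' q' uv].
- exact: word_eq_refl.
- exact: word_eq_sym.
- exact: word_eq_trans.
- by rewrite -!catA; exact: word_eq_cancel.
- by rewrite -!catA; exact: word_eq_rel.
Qed.

Lemma word_eq_cat u u' v v' : u =~ u' -> v =~ v' -> u ++ v =~ u' ++ v'.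
Proof.
move=> uu' vv'; apply: (@word_eq_trans _ _ _ (u' ++ v)).
  exact: word_eq_catr.
exact: word_eq_catl.
Qed.

Lemma word_eq_mulwV w : w ++ inv_word w =~ [::].
Proof.
elim/last_ind: w => [|w a IHw]; first exact: word_eq_refl.
rewrite -cats1 inv_word_cat; apply: word_eq_trans IHw.
by rewrite -!catA; exact: word_eq_cancel.
Qed.

Lemma word_eq_mulVw w : inv_word w ++ w =~ [::].
Proof. by have := word_eq_mulwV (inv_word w); rewrite inv_wordK. Qed.

Lemma word_eq_inv u v : u =~ v -> inv_word u =~ inv_word v.
Proof.
move=> uv; apply: (@word_eq_trans _ _ _ (inv_word u ++ (v ++ inv_word v))).
  rewrite -[X in X =~ _]cats0; apply/word_eq_catl/word_eq_sym.
  exact: word_eq_mulwV.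
rewrite catA -[X in _ =~ X]cat0s; apply: word_eq_catr.
apply: (@word_eq_trans _ _ _ (inv_word u ++ u)); last exact: word_eq_mulVw.
exact/word_eq_catl/word_eq_sym.
Qed.

Definition word_eqb : rel (word T) := fun u v => `[< u =~ v >].

Lemma word_eqb_refl : reflexive word_eqb.
Proof. by move=> w; apply/asboolP; exact: word_eq_refl. Qed.

Lemma word_eqb_sym : symmetric word_eqb.
Proof. by move=> u v; apply/asboolP/asboolP; exact: word_eq_sym. Qed.

Lemma word_eqb_trans : transitive word_eqb.
Proof.
move=> v u w /asboolP uv /asboolP vw; apply/asboolP.
exact: word_eq_trans uv vw.
Qed.

Canonical word_eqb_equiv :=
  EquivRel word_eqb word_eqb_refl word_eqb_sym word_eqb_trans.

Definition presented_group : Type := {eq_quot word_eqb_equiv}.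

HB.instance Definition _ := Choice.on presented_group.

Definition word_val (w : word T) : presented_group :=
  \pi_({eq_quot word_eqb_equiv}) w.

Let rep (g : presented_group) : word T :=
  repr (g : {eq_quot word_eqb_equiv}).

Let repK : cancel rep word_val.
Proof. by move=> g; rewrite /word_val /rep reprK. Qed.

Lemma word_valP u v : word_val u = word_val v <-> u =~ v.
Proof.
split=> [uv|uv].
  have /eqmodP/asboolP// : u = v %[mod {eq_quot word_eqb_equiv}] by exact: uv.
by apply/eqmodP/asboolP.
Qed.

Let rep_val w : rep (word_val w) =~ w.
Proof. by apply/word_valP; rewrite repK. Qed.

Definition pg_one : presented_group := word_val [::].

Definition pg_mul (g h : presented_group) : presented_group :=
  word_val (rep g ++ rep h).

Definition pg_inv (g : presented_group) : presented_group :=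
  word_val (inv_word (rep g)).

Lemma word_val_cat u v : word_val (u ++ v) = pg_mul (word_val u) (word_val v).
Proof.
by apply/word_valP/word_eq_sym/word_eq_cat; exact: rep_val.
Qed.

Lemma word_val_inv w : word_val (inv_word w) = pg_inv (word_val w).
Proof. by apply/word_valP/word_eq_sym/word_eq_inv; exact: rep_val. Qed.

Lemma pg_mulA : associative pg_mul.
Proof.
move=> g h k; rewrite -(repK g) -(repK h) -(repK k).
by rewrite -!word_val_cat catA.
Qed.

Lemma pg_mul1g : left_id pg_one pg_mul.
Proof. by move=> g; rewrite -(repK g) -word_val_cat. Qed.

Lemma pg_mulg1 : right_id pg_one pg_mul.
Proof. by move=> g; rewrite -(repK g) -word_val_cat cats0. Qed.

Lemma pg_mulVg : left_inverse pg_one pg_inv pg_mul.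
Proof.
move=> g; rewrite -(repK g) -word_val_inv -word_val_cat.
by apply/word_valP; exact: word_eq_mulVw.
Qed.

Lemma pg_mulgV : right_inverse pg_one pg_inv pg_mul.
Proof.
move=> g; rewrite -(repK g) -word_val_inv -word_val_cat.
by apply/word_valP; exact: word_eq_mulwV.
Qed.

HB.instance Definition _ := isGroup.Build presented_group
  pg_mulA pg_mul1g pg_mulg1 pg_mulVg pg_mulgV.

Lemma word_val_nil : word_val [::] = 1%g.
Proof. by []. Qed.

Lemma word_valM u v : word_val (u ++ v) = (word_val u * word_val v)%g.
Proof. exact: word_val_cat. Qed.

Lemma word_valV w : word_val (inv_word w) = ((word_val w)^-1)%g.
Proof. exact: word_val_inv. Qed.

End PresentedGroup.

(* The value of the label off the edges is irrelevant. *)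
Record artin_graph := ArtinGraph {
  vertex : finType;
  edge : rel vertex;
  label : vertex -> vertex -> nat;
  edge_irr : irreflexive edge;
  edge_sym : symmetric edge;
  label_sym : forall x y, edge x y -> label x y = label y x;
  label_ge2 : forall x y, edge x y -> 2 <= label x y
}.

(* The word x y x y ... of length m. *)
Definition alternating (T : Type) (m : nat) (x y : T) : word T :=
  mkseq (fun k => (if odd k then y else x, true)) m.

Definition artin_rel (G : artin_graph) (u v : word (vertex G)) : Prop :=
  exists x y : vertex G, [/\ edge x y,
    u = alternating (label x y) x y & v = alternating (label x y) y x].

Definition artin_group (G : artin_graph) : groupType :=
  presented_group (@artin_rel G).

Definition eval (G : artin_graph) (w : word (vertex G)) : artin_group G :=
  word_val (@artin_rel G) w.

Definition positive_monoid (G : artin_graph) : set (artin_group G) :=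
  [set g | exists2 w : word (vertex G), positive w & eval w = g]%classic.
Arguments positive_monoid : clear implicits.

Definition cayley (A : groupType) (M : set A) : rel A :=
  fun g h => `[< exists2 m, M m & (h = g * m)%g \/ (g = h * m)%g >].

(* Some path from x to y has d edges, and none has fewer. *)
Definition is_distance (V : eqType) (e : rel V) (x y : V) (d : nat) : Prop :=
  (exists p, [/\ path e x p, last x p = y & size p = d]) /\
  (forall p, path e x p -> last x p = y -> d <= size p).

(* The path metric takes arbitrarily large (finite) values on vertices. *)
Definition infinite_diameter (V : eqType) (e : rel V) : Prop :=
  forall N : nat, exists x y d, is_distance e x y d /\ N < d.

Definition geodesic (G : artin_graph) (w : word (vertex G)) : Prop :=
  forall v : word (vertex G), eval v = eval w -> size w <= size v.

Definition proper_suffix (T : eqType) (u w : seq T) : bool :=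
  suffix u w && (u != w).

Definition longest_signed_suffix (T : eqType) (b : bool) (u w : word T) :=
  [/\ proper_suffix u w, signed b u &
      forall v, proper_suffix v w -> signed b v -> size v <= size u].

Definition preserved_suffixes (G : artin_graph) (b : bool) : Prop :=
  forall (w : word (vertex G)) (l a : letter (vertex G)) (u : word (vertex G)),
    geodesic (rcons w l) -> l.2 = b -> a.2 = b ->
    longest_signed_suffix b u (rcons w l) ->
    exists v, [/\ geodesic v, eval v = eval (a :: rcons w l) & suffix u v].

Definition preserved_positive_suffixes (G : artin_graph) : Prop :=
  preserved_suffixes G true.

Definition preserved_negative_suffixes (G : artin_graph) : Prop :=
  preserved_suffixes G false.

Definition preserved_signed_suffixes (G : artin_graph) : Prop :=
  preserved_positive_suffixes G /\ preserved_negative_suffixes G.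

Definition blocking_pair (G : artin_graph) (u : word (vertex G))
    (x : letter (vertex G)) : Prop :=
  forall w : word (vertex G), geodesic (w ++ u) -> geodesic (w ++ u ++ [:: x]).

(* Indices start at 1: the value alpha 0 is never used.  The occurrences of
   letters in alpha n are the decompositions alpha n = p ++ x :: q. *)
Definition alternating_blocking_sequence (G : artin_graph)
    (alpha : nat -> word (vertex G)) : Prop :=
  (forall n, 1 <= n -> alpha n != [::] /\
     (if odd n then positive (alpha n) else negative (alpha n))) /\
  (forall n, 2 <= n -> forall p x q, alpha n = p ++ x :: q ->
     exists2 u, suffix u (alpha n.-1 ++ p) & blocking_pair u x).

(* Main.v *)
Require Import Defs.
From HB Require Import structures.
From mathcomp Require Import all_boot.
From mathcomp Require Import boolp classical_sets.
From mathcomp Require Import zify.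

(** Reading a path in the Cayley graph through inverses, each edge multiplies
    the current element on the left by a signed word.  If a geodesic ends in
    [alpha j], blocking makes it stay geodesic after appending [alpha j.+1],
    and preservation of signed suffixes says that left multiplication by a word
    of the sign of [alpha j] (respectively [alpha j.+1]) leaves a geodesic still
    ending in [alpha j] (respectively [alpha j.+1]).  So each edge uses up at
    most one block, and the inverse of [alpha 1 ... alpha n.+1] is at distance
    more than [n] from the identity. *)

Set Implicit Arguments.
Unset Strict Implicit.
Unset Printing Implicit Defensive.

Lemma suffix_size_le (T : eqType) (u v w : seq T) :
  suffix u w -> suffix v w -> size u <= size v -> suffix u v.
Proof.
move=> /suffixP [p ->] /suffixP [q wE] le.
have le_qp : size q <= size p.
  by have := congr1 size wE; rewrite !size_cat; lia.
have <- : drop (size q) (p ++ u) = v by rewrite wE drop_size_cat.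
rewrite drop_cat; case: ltnP => [_|le_pq]; first exact: suffix_suffix.
have -> : size q - size p = 0 by lia.
by rewrite drop0 suffix_refl.
Qed.

Section ArtinWords.
Context (G : artin_graph).
Implicit Types (u v w m s : word (vertex G)) (b : bool).

Lemma signed_inv_word b w : signed b (inv_word w) = signed (~~ b) w.
Proof.
rewrite /signed /inv_word all_rev all_map; apply: eq_all => -[x c] /=.
by case: b c => [] [].
Qed.

(* Additive form of the invariance of the exponent sum. *)
Lemma word_eq_exponent u v : word_eq (@artin_rel G) u v ->
  count (fun a => a.2) u + count (fun a => ~~ a.2) v =
  count (fun a => a.2) v + count (fun a => ~~ a.2) u.
Proof.
have alt k (x y : vertex G) : signed true (alternating k x y).
  by rewrite /signed all_map; apply/allP.
elim=> [//|u' v' _ ->//|u' v' w' _ + _|p a q|p u' v' q].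
- by lia.
- by rewrite !count_cat /=; case: a.2 => /=; lia.
- move=> [x [y [_ -> ->]]].
  have cp k (z t : vertex G) : count (fun a => a.2) (alternating k z t) = k.
    rewrite -[RHS](size_mkseq (fun i => (if odd i then t else z, true))).
    apply/eqP; rewrite -all_count; apply: sub_all (alt k z t).
    by move=> a /eqP.
  have cn k (z t : vertex G) : count (fun a => ~~ a.2) (alternating k z t) = 0.
    apply/eqP; rewrite eqn0Ngt -has_count -all_predC.
    by apply: sub_all (alt k z t) => a /eqP /= ->.
  by rewrite !count_cat !cp !cn; lia.
Qed.

(** The exponent sum depends only on the element represented, and its absolute value bounds the
    length of any word from below; a signed word attains this bound. *)
Lemma signed_geodesic b w : signed b w -> geodesic w.
Proof.
move=> bw v /word_valP /word_eq_exponent.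
have sizeE s : size s = count (fun a => a.2) s + count (fun a => ~~ a.2) s.
  by rewrite -(count_predC (fun a => a.2) s).
rewrite !sizeE.
have : count (fun a => if b then ~~ a.2 else a.2) w = 0.
  apply/eqP; rewrite eqn0Ngt -has_count -all_predC.
  by apply: sub_all bw => a /eqP /= ->; case: b.
by case: b {bw} => /=; lia.
Qed.

Lemma geodesic_exists w : exists2 v, geodesic v & eval v = eval w.
Proof.
have ex : exists n, `[< exists2 v, eval v = eval w & size v = n >].
  by exists (size w); apply/asboolP; exists w.
case: (ex_minnP ex) => n /asboolP [v vw <-] min.
exists v => // v' v'v; apply: min; apply/asboolP.
by exists v' => //; rewrite v'v.
Qed.

Lemma longest_signed_suffix_exists b u w : proper_suffix u w -> signed b u ->
  exists2 u', longest_signed_suffix b u' w & suffix u u'.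
Proof.
move=> uw bu.
pose P n := `[< exists2 v, proper_suffix v w & signed b v /\ size v = n >].
have ex : exists n, P n by exists (size u); apply/asboolP; exists u.
have bound n : P n -> n <= size w.
  by move=> /asboolP [v /andP [vw _] [_ <-]]; exact: size_suffix.
case: (ex_maxnP ex bound) => n /asboolP [u' u'w [bu' <-]] max.
have long v : proper_suffix v w -> signed b v -> size v <= size u'.
  by move=> vw bv; apply: max; apply/asboolP; exists v.
exists u' => //; have := long _ uw bu.
case/andP: uw u'w => uw _ /andP [u'w _] le.
by apply: (suffix_size_le uw u'w); exact: le.
Qed.

Lemma eval_cat u v : eval (u ++ v) = (eval u * eval v)%g.
Proof. exact: word_valM. Qed.

(** Induction on [m], one letter at a time: the preserved suffix is the longest one of sign [b], and
    it contains [u]. *)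
Lemma geodesic_signed_mul b m u w : preserved_suffixes G b ->
    signed b m -> signed b u -> geodesic w -> suffix u w ->
  exists v, [/\ geodesic v, eval v = eval (m ++ w) & suffix u v].
Proof.
move=> pres + bu gw uw; elim: m => [|a m IHm] /=; first by exists w.
case/andP => /eqP ba /IHm [v [gv vE uv]].
have avE : eval (a :: v) = eval (a :: m ++ w).
  by rewrite -cat1s eval_cat vE -eval_cat.
(* With [u] empty, [v] may end in a letter of the other sign, so preservation need not apply; any
   geodesic serves. *)
have [u0|u_neq0] := eqVneq u [::].
  have [v' gv' v'E] := geodesic_exists (a :: m ++ w).
  by exists v'; split=> //; rewrite u0 suffix0s.
have [uv_eq|uv_neq] := eqVneq u v.
  (* Here [u] is not a proper suffix of [v], but [a :: v] is signed and hence already geodesic. *)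
  exists (a :: v); split=> //.
  2: by rewrite uv_eq; exact: (suffix_suffix [:: a]).
  by apply: (@signed_geodesic b); rewrite -uv_eq /= ba eqxx.
have [u' u'long uu'] : exists2 u', longest_signed_suffix b u' v & suffix u u'.
  by apply: longest_signed_suffix_exists; rewrite // /proper_suffix uv.
case/lastP: u u_neq0 bu {uw uv_neq IHm} uv uu' => // u l _.
rewrite /signed all_rcons => /andP [/eqP bl _] /suffixP [q vq] uu'.
rewrite -rcons_cat in vq; rewrite {}vq in gv avE u'long.
have [v' [gv' v'E u'v']] := pres _ _ _ _ gv bl ba u'long.
exists v'; split=> //; first by rewrite v'E.
exact: suffix_trans u'v'.
Qed.

Lemma geodesic_cat_blocking s w v : geodesic w -> suffix s w ->
    (forall p x q, v = p ++ x :: q ->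
       exists2 u, suffix u (s ++ p) & blocking_pair u x) ->
  geodesic (w ++ v).
Proof.
move=> gw /suffixP [t wE] blk.
(* The blocking condition refers to positions in the whole of [v], so the induction runs over its
   prefixes [p] with [v] fixed. *)
suff pref p q : v = p ++ q -> geodesic (w ++ p).
  by apply: (pref _ [::]); rewrite cats0.
elim/last_ind: p q => [|p x IHp] q; first by rewrite cats0.
rewrite cat_rcons => vE.
have [u /suffixP [r rE] ux] := blk _ _ _ vE.
have wpE : w ++ p = (t ++ r) ++ u by rewrite wE -!catA rE.
rewrite -cats1 catA wpE -(catA (t ++ r)); apply: ux; rewrite -wpE.
exact: IHp vE.
Qed.

(** Inversion moves the multiplication to the left, the side on which suffixes are preserved; the
    orientation of the edge decides the sign. *)
Lemma cayley_edgeV (x y : artin_group G) : cayley (positive_monoid G) x y ->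
  exists b m, signed b m /\ (y^-1 = eval m * x^-1)%g.
Proof.
move=> /asboolP [_ [m pm <-] [->|->]].
  exists false, (inv_word m); rewrite signed_inv_word; split=> //.
  by rewrite invgM /eval word_valV.
by exists true, m; split=> //; rewrite invgM mulgA mulgV mul1g.
Qed.

(** Deleting the last letter of [w] follows an edge. This makes the distances to the identity
    finite, as [infinite_diameter] requires. *)
Lemma cayley_path_to1 w : exists p,
  path (cayley (positive_monoid G)) (eval w) p /\ last (eval w) p = 1%g.
Proof.
elim/last_ind: w => [|w a [p [pw pl]]]; first by exists [::].
exists (eval w :: p); split=> //=; rewrite pw andbT; apply/asboolP.
have wE : eval (rcons w a) = (eval w * eval [:: a])%g by rewrite -cats1 eval_cat.
case a2 : a.2.
  by exists (eval [:: a]); [exists [:: a]; rewrite //= /positive /= a2 | right].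
exists (eval (inv_word [:: a])).
  by exists (inv_word [:: a]); rewrite // /positive /= a2.
by left; rewrite wE /eval word_valV -mulgA mulgV mulg1.
Qed.

Lemma path_distance (V : eqType) (e : rel V) x p : path e x p ->
  exists d, is_distance e x (last x p) d.
Proof.
move=> ep.
pose P n := `[< exists q, [/\ path e x q, last x q = last x p & size q = n] >].
have ex : exists n, P n by exists (size p); apply/asboolP; exists p.
case: (ex_minnP ex) => d /asboolP dP min; exists d; split=> // q eq ql.
by apply: min; apply/asboolP; exists q.
Qed.

Section BlockingSequence.
Variable alpha : nat -> word (vertex G).
Hypothesis pres : forall b, preserved_suffixes G b.
Hypothesis alphaP : alternating_blocking_sequence alpha.

Lemma signed_alpha j : 0 < j -> signed (odd j) (alpha j).
Proof. by move=> /(alphaP.1 _) [_]; case: odd. Qed.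

Lemma geodesic_cat_alpha j w : 0 < j -> geodesic w -> suffix (alpha j) w ->
  geodesic (w ++ alpha j.+1).
Proof.
by move=> j0 gw jw; apply: geodesic_cat_blocking gw jw _; exact: (alphaP.2 j.+1).
Qed.

Definition blocks (j k : nat) : word (vertex G) :=
  flatten [seq alpha i | i <- iota j k].

Lemma geodesic_cat_blocks j k w : 0 < j -> geodesic w -> suffix (alpha j) w ->
  geodesic (w ++ blocks j.+1 k).
Proof.
elim: k j w => [|k IHk] j w j0 gw jw; first by rewrite cats0.
rewrite /blocks /= catA; apply: IHk => //; last exact: suffix_suffix.
exact: geodesic_cat_alpha.
Qed.

(** Invariant along the path: the inverse of the current vertex is a geodesic ending in [alpha j]
    followed by [k] untouched blocks, and an edge lowers [k] by at most one. *)
Lemma path_to1_blocks p x j k w : path (cayley (positive_monoid G)) x p ->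
    last x p = 1%g -> 0 < j -> geodesic w -> suffix (alpha j) w ->
    (x^-1)%g = eval (w ++ blocks j.+1 k) ->
  k < size p.
Proof.
elim: p x j k w => [|y p IHp] x j k w /=.
  move=> _ -> j0 gw jw; rewrite invg1 => xE.
  (* At the identity this geodesic would be empty, although [alpha j] is not; so the path cannot be
     empty. *)
  have := @geodesic_cat_blocks j k w j0 gw jw [::] xE.
  rewrite size_cat [size [::]]/= [_ + _ <= 0]leqn0 addn_eq0.
  case/andP => /nilP w0 _.
  have := (alphaP.1 j j0).1.
  by move: jw; rewrite w0 suffixs0 => /eqP ->.
case/andP => /cayley_edgeV [b [m [bm yE]]] yp yl j0 gw jw xE.
rewrite xE -eval_cat catA in yE.
(* If the edge has the sign of [alpha j], no block is used up. *)
have [bj|bj] := eqVneq b (odd j).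
  have bu : signed b (alpha j) by rewrite bj signed_alpha.
  have [v [gv vE jv]] := geodesic_signed_mul (@pres b) bm bu gw jw.
  rewrite ltnS ltnW //; apply: (IHp y j k v) => //.
  by rewrite yE !(eval_cat _ (blocks _ _)) vE.
(* Otherwise the edge has the sign of [alpha j.+1], which is first absorbed into the geodesic; with
   no block left, the edge itself gives the bound. *)
case: k yE {xE} => [//|k] yE.
have bu : signed b (alpha j.+1).
  by have := signed_alpha (ltn0Sn j); case: b bj {bm} => /=; case: (odd j).
have gwj := geodesic_cat_alpha j0 gw jw.
have [v [gv vE jv]] :=
  geodesic_signed_mul (@pres b) bm bu gwj (suffix_suffix w (alpha j.+1)).
rewrite ltnS; apply: (IHp y j.+1 k v) => //.
by rewrite yE /blocks /= catA -(catA m) 2!(eval_cat _ (flatten _)) vE.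
Qed.

End BlockingSequence.
End ArtinWords.

Theorem theorem4p5 (G : artin_graph) :
  preserved_signed_suffixes G ->
  (exists alpha : nat -> word (vertex G),
     alternating_blocking_sequence alpha) ->
  infinite_diameter (cayley (positive_monoid G)).
Proof.
move=> [presP presN] [alpha alphaP] N.
have pres b : preserved_suffixes G b by case: b.
pose w := alpha 1 ++ blocks alpha 2 N.
have [p [wp pl]] := cayley_path_to1 (inv_word w).
have [d dP] := path_distance wp; rewrite pl in dP.
exists (eval (inv_word w)), 1%g, d; split=> //.
case: dP => -[q [wq ql <-]] _.
(* The invariant starts with the geodesic [alpha 1] and [N] further blocks. *)
apply: (path_to1_blocks pres alphaP wq ql (ltn0Sn 0) _ (suffix_refl (alpha 1))).
  exact: signed_geodesic (signed_alpha alphaP (ltn0Sn 0)).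
by rewrite /eval word_valV invgK.
Qed.
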